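(* Let $K=\mathbb{F}_q$ be a finite field with $q\neq 2$, let $G$ be a graph, and let $X\subset\mathbb{P}^{s-1}$ and $Y\subset\mathbb{P}^{s}$ be the sets parameterized by the edges of $G$ (defined in the context). Then: (i) $|Y|=(q-1)|X|$ if $G$ is bipartite; (ii) $|Y|=(q-1)|X|$ if $\gcd(q-1,2)=1$; (iii) $|Y|=\frac{q-1}{2}|X|$ if $G$ is not bipartite and $\gcd(q-1,2)\neq 1$.
   Context: Graphs are finite and simple. Let $G$ have vertex set $\{y_1,\ldots,y_n\}$ and edges $f_1,\ldots,f_s$ ($s\geq 1$), and let $v_i=e_j+e_k\in\{0,1\}^n$ be the characteristic vector of $f_i=\{y_j,y_k\}$. Put $K^*=K\setminus\{0\}$ and, for $x\in (K^* )^n$, $x^{v_i}=x_1^{v_{i1}}\cdots x_n^{v_{in}}$. Define $X=\{[(x^{v_1},\ldots,x^{v_s})] : x\in (K^* )^n\}\subset\mathbb{P}^{s-1}$ and $Y=\{[(x^{v_1},\ldots,x^{v_s},1)] : x\in (K^* )^n\}\subset\mathbb{P}^{s}$, projective spaces over $K$. A graph is bipartite if its vertex set can be partitioned into two disjoint subsets $V_1,V_2$ such that every edge has one end in $V_1$ and one end in $V_2$. *)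

(* Defs.v *)
From mathcomp Require Import all_boot all_order all_algebra.

Set Implicit Arguments.
Unset Strict Implicit.
Unset Printing Implicit Defensive.

Import GRing.Theory.
Local Open Scope ring_scope.

Record sgraph (n : nat) := SGraph {
  edges : {set {set 'I_n}};
  edges_card2 : forall e, e \in edges -> #|e| = 2
}.

Definition bipartite (n : nat) (G : sgraph n) : Prop :=
  exists V1 V2 : {set 'I_n},
    [/\ V1 :|: V2 = setT,
        [disjoint V1 & V2] &
        forall e, e \in edges G ->
          exists y z, [/\ y \in V1, z \in V2 & e = [set y; z]]].

(* [f 0], ..., [f (s - 1)] lists the edges of G, each exactly once. *)
Definition edge_listing (n s : nat) (G : sgraph n) (f : 'I_s -> {set 'I_n}) :=
  injective f /\ [set f i | i : 'I_s] = edges G.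

Definition char_vec (n : nat) (e : {set 'I_n}) : 'rV[nat]_n :=
  \row_j (j \in e : nat).

Section Parameterization.

Variable K : finFieldType.

(* The points of the projective space with m homogeneous coordinates (of
   dimension m - 1) are the classes of nonzero vectors under scaling by K^*,
   each class being represented as a set of vectors. *)
Definition proj_equiv (m : nat) (u v : 'rV[K]_m) : bool :=
  [exists c : K, (c != 0) && (v == c *: u)].

Definition proj_class (m : nat) (u : 'rV[K]_m) : {set 'rV[K]_m} :=
  [set v | proj_equiv u v].

Definition proj_space (m : nat) : {set {set 'rV[K]_m}} :=
  [set proj_class u | u : 'rV[K]_m & u != 0].

Definition torus (n : nat) : {set 'rV[K]_n} :=
  [set x : 'rV[K]_n | [forall j, x 0 j != 0]].

Definition monomial (n : nat) (x : 'rV[K]_n) (v : 'rV[nat]_n) : K :=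
  \prod_j x 0 j ^+ v 0 j.

Definition edge_monomials (n s : nat) (f : 'I_s -> {set 'I_n})
    (x : 'rV[K]_n) : 'rV[K]_s :=
  \row_i monomial x (char_vec (f i)).

Definition Xset (n s : nat) (f : 'I_s -> {set 'I_n}) : {set {set 'rV[K]_s}} :=
  [set proj_class (edge_monomials f x) | x in torus n].

Definition Yset (n s : nat) (f : 'I_s -> {set 'I_n}) :
    {set {set 'rV[K]_(s + 1)}} :=
  [set proj_class (row_mx (edge_monomials f x) (const_mx 1)) | x in torus n].

Lemma proj_equiv_refl (m : nat) : reflexive (@proj_equiv m).
Proof. by move=> u; apply/existsP; exists 1; rewrite oner_neq0 scale1r eqxx. Qed.

Lemma proj_equiv_sym (m : nat) : symmetric (@proj_equiv m).
Proof.
suff H : forall u v : 'rV[K]_m, proj_equiv u v -> proj_equiv v u.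
  by move=> u v; apply/idP/idP; apply: H.
move=> u v /existsP[c /andP[c0 /eqP->]]; apply/existsP; exists c^-1.
by rewrite invr_eq0 c0 scalerA mulVf // scale1r eqxx.
Qed.

Lemma proj_equiv_trans (m : nat) : transitive (@proj_equiv m).
Proof.
move=> v u w /existsP[c /andP[c0 /eqP->]] /existsP[d /andP[d0 /eqP->]].
by apply/existsP; exists (d * c); rewrite mulf_neq0 // scalerA eqxx.
Qed.

Lemma proj_class_eq (m : nat) (u v : 'rV[K]_m) :
  (proj_class u == proj_class v) = proj_equiv u v.
Proof.
apply/eqP/idP => [E|uv].
  have : v \in proj_class v by rewrite inE proj_equiv_refl.
  by rewrite -E inE.
apply/setP => w; rewrite !inE; apply/idP/idP; last exact: proj_equiv_trans.
by apply: proj_equiv_trans; rewrite proj_equiv_sym.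
Qed.

Lemma Xset_sub (n s : nat) (f : 'I_s -> {set 'I_n}) :
  (0 < s)%N -> Xset f \subset proj_space s.
Proof.
move=> s0; apply/subsetP => _ /imsetP[x xT ->]; apply/imsetP.
exists (edge_monomials f x) => //; rewrite inE.
apply/eqP => /rowP /(_ (Ordinal s0)); rewrite !mxE => /eqP; apply/negP.
apply/prodf_neq0 => j _; rewrite expf_neq0 //.
by move: xT; rewrite inE => /forallP.
Qed.

Lemma Yset_sub (n s : nat) (f : 'I_s -> {set 'I_n}) :
  Yset f \subset proj_space (s + 1).
Proof.
apply/subsetP => _ /imsetP[x _ ->]; apply/imsetP.
exists (row_mx (edge_monomials f x) (const_mx 1)) => //; rewrite inE.
apply/eqP => /rowP /(_ (rshift s 0)); rewrite row_mxEr !mxE.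
by move/eqP; rewrite oner_eq0.
Qed.

End Parameterization.

Arguments Xset K {n s} f.
Arguments Yset K {n s} f.

(* Main.v *)
(** Let [M] be the set of vectors of edge monomials. It is a subgroup of
    [(K^* )^s], and normalizing the last coordinate to 1 shows [|Y| = |M|].
    The fibres of [M -> X] are the orbits of the group [C] of scalars [c] with
    [(c, ..., c)] in [M], so [|Y| = |C| |X|]. Always [C] contains the squares.
    If [G] is bipartite, giving [c] to one side and 1 to the other shows
    [C = K^*]. Conversely, if [x_j x_k = c] on every edge for a nonsquare [c],
    then (in odd characteristic) exactly one end of each edge carries a square,
    so squares and nonsquares bipartition [G]. *)

Require Import Defs.
From mathcomp Require Import all_boot all_order all_algebra.
From mathcomp Require Import fingroup cyclic finfield.

Set Implicit Arguments.
Unset Strict Implicit.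
Unset Printing Implicit Defensive.

Import GRing.Theory.
Local Open Scope ring_scope.

(** Partition [A] by the values of [h]. This count serves both squaring on [K^*] and the projection
    of edge vectors to [X]. *)
Lemma card_imset_fibres (aT rT : finType) (h : aT -> rT) (A : {set aT}) k :
  {in A, forall x, #|[set y in A | h y == h x]| = k} ->
  #|A| = (k * #|h @: A|)%N.
Proof.
move=> hk; rewrite mulnC -sum1_card (partition_big_imset h) /= -sum_nat_const.
apply: eq_bigr => _ /imsetP[x xA ->]; rewrite -(hk x xA) -sum1_card.
by apply: eq_bigl => y; rewrite inE.
Qed.

(** * Squares in a finite field *)

Section FiniteFieldSquares.

Variable K : finFieldType.

Definition nonzero_squares : {set K} := [set x ^+ 2 | x in [set~ 0]].

Lemma card_nonzero : #|[set~ (0 : K)]| = #|K|.-1.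
Proof. by rewrite cardsC1. Qed.

Lemma nonzero_squares_neq0 c : c \in nonzero_squares -> c != 0.
Proof. by move=> /imsetP[x]; rewrite !inE => x0 ->; rewrite expf_neq0. Qed.

(** Since [c ^+ #|K| = c], halving the even exponent gives a square root. *)
Lemma even_card_square (c : K) : ~~ odd #|K| -> c = (c ^+ #|K|./2) ^+ 2.
Proof. by move=> qe; rewrite -exprM muln2 even_halfK // expf_card. Qed.

(** By Lagrange in the additive group, [#|K|] kills [x]. If also [x + x = 0], oddness of [#|K|]
    leaves [x = 0]. *)
Lemma odd_card_oppr_neq (x : K) : odd #|K| -> x != 0 -> x != - x.
Proof.
move=> qo x0; apply: contra x0; rewrite -addr_eq0 => /eqP xx0.
have : x *+ #|K| = 0.
  by have := expg_cardG (in_setT x); rewrite cardsT FinRing.zmodXgE.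
rewrite -[#|K|]odd_double_half qo -mul2n mulrnDr mulrnA mulr2n xx0 mul0rn.
by rewrite addr0 => /eqP.
Qed.

(** Squaring on [K^*] is two-to-one, with fibres [{x, - x}]. *)
Lemma card_nonzero_squares :
  odd #|K| -> #|[set~ (0 : K)]| = (2 * #|nonzero_squares|)%N.
Proof.
move=> qo; apply: card_imset_fibres => x; rewrite !inE => x0.
have -> : [set y in [set~ 0] | y ^+ 2 == x ^+ 2] = [set x; - x].
  apply/setP => y; rewrite !inE eqf_sqr andb_idl // => /orP[] /eqP-> //.
  by rewrite oppr_eq0.
by rewrite cards2 odd_card_oppr_neq.
Qed.

(* The coset [a S] of the squares [S] is disjoint from [S] and of the same size,
   hence is the whole complement, which contains [b]. *)
Lemma nonsquare_mul (a b : K) :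
  odd #|K| -> a != 0 -> b != 0 ->
  a \notin nonzero_squares -> b \notin nonzero_squares ->
  a * b \in nonzero_squares.
Proof.
move=> qo a0 b0 aS bS; set S := nonzero_squares.
have divS c d : c != 0 -> d * c ^+ 2 \in S -> d \in S.
  move=> c0 /imsetP[e]; rewrite !inE => e0 E; apply/imsetP; exists (e / c).
    by rewrite !inE mulf_neq0 ?invr_eq0.
  by rewrite expr_div_n -E mulfK // expf_neq0.
have dis : [disjoint S & [set a * t | t in S]].
  apply/pred0P => c /=; apply/negP => /andP[cS /imsetP[_ /imsetP[d d0 ->] E]].
  move: d0; rewrite !inE => d0.
  by case/negP: aS; apply: (divS d) => //; rewrite -E.
have cover : S :|: [set a * t | t in S] = [set~ 0].
  apply/eqP; rewrite eqEcard; apply/andP; split.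
    apply/subsetP => c; rewrite !inE => /orP[/nonzero_squares_neq0 //|].
    by case/imsetP => d /nonzero_squares_neq0 d0 ->; rewrite mulf_neq0.
  rewrite card_nonzero_squares // cardsU (disjoint_setI0 dis) cards0 subn0.
  by rewrite card_imset ?addnn ?mul2n //; apply: mulfI.
have : b \in [set~ 0] by rewrite !inE.
rewrite -cover inE (negbTE bS) /= => /imsetP[_ /imsetP[d d0 ->] ->].
(* Here [b] has become [a * d ^+ 2], so [a * b] is the square of [a * d]. *)
move: d0; rewrite !inE => d0; apply/imsetP; exists (a * d).
  by rewrite !inE mulf_neq0.
by rewrite mulrA -expr2 exprMn.
Qed.

End FiniteFieldSquares.

(** * The group of edge vectors and its scalars *)

Section EdgeMonomials.

Variables (K : finFieldType) (n s : nat) (f : 'I_s -> {set 'I_n}).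

(** The group [M]. *)
Definition edge_torus : {set 'rV[K]_s} :=
  [set edge_monomials f x | x in torus K n].

(** The group [C], the stabilizer of [M] under scaling. *)
Definition edge_scalars : {set K} :=
  [set c : K | (c != 0) && (const_mx c \in edge_torus)].

Lemma torusP (x : 'rV[K]_n) : reflect (forall j, x 0 j != 0) (x \in torus K n).
Proof. by rewrite inE; apply: forallP. Qed.

Lemma edge_monomialsE (x : 'rV[K]_n) i :
  edge_monomials f x 0 i = \prod_(j in f i) x 0 j.
Proof.
rewrite mxE /monomial [RHS]big_mkcond; apply: eq_bigr => j _.
by rewrite mxE; case: (j \in f i).
Qed.

Lemma edge_torus_neq0 u i : u \in edge_torus -> u 0 i != 0.
Proof.
move=> /imsetP[x /torusP x0 ->]; rewrite edge_monomialsE.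
by apply/prodf_neq0 => j _.
Qed.

Lemma edge_torus_mul u v :
  u \in edge_torus -> v \in edge_torus ->
  \row_i (u 0 i * v 0 i) \in edge_torus.
Proof.
move=> /imsetP[x /torusP x0 ->] /imsetP[y /torusP y0 ->].
apply/imsetP; exists (\row_j (x 0 j * y 0 j)).
  by apply/torusP => j; rewrite mxE mulf_neq0.
apply/rowP => i; rewrite mxE !edge_monomialsE -big_split /=.
by apply: eq_bigr => j _; rewrite mxE.
Qed.

Lemma edge_torus_inv u :
  u \in edge_torus -> \row_i (u 0 i)^-1 \in edge_torus.
Proof.
move=> /imsetP[x /torusP x0 ->].
apply/imsetP; exists (\row_j (x 0 j)^-1).
  by apply/torusP => j; rewrite mxE invr_eq0.
apply/rowP => i; rewrite mxE !edge_monomialsE -prodfV.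
by apply: eq_bigr => j _; rewrite mxE.
Qed.

(** In the group [M], multiply by [u] or by its inverse. *)
Lemma edge_torus_scale c u :
  u \in edge_torus -> (c *: u \in edge_torus) = (const_mx c \in edge_torus).
Proof.
move=> uM; apply/idP/idP => cM.
  have -> : const_mx c = \row_i ((c *: u) 0 i * (\row_k (u 0 k)^-1) 0 i).
    by apply/rowP => i; rewrite !mxE mulfK ?edge_torus_neq0.
  by rewrite edge_torus_mul ?edge_torus_inv.
have -> : c *: u = \row_i ((const_mx c : 'rV_s) 0 i * u 0 i).
  by apply/rowP => i; rewrite !mxE.
by rewrite edge_torus_mul.
Qed.

Lemma card_Yset : #|Yset K f| = #|edge_torus|.
Proof.
have -> : Yset K f = [set proj_class (row_mx u (const_mx 1)) | u in edge_torus].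
  by rewrite /edge_torus -imset_comp.
rewrite card_imset // => u v /eqP; rewrite proj_class_eq => /existsP[c].
(* Comparing the last coordinates, both 1, forces [c = 1]. *)
case/andP=> _ /eqP; rewrite scale_row_mx => /eq_row_mx[-> /rowP/(_ 0)].
by rewrite !mxE mulr1 => <-; rewrite scale1r.
Qed.

Lemma card_edge_torus :
  (0 < s)%N -> #|edge_torus| = (#|edge_scalars| * #|Xset K f|)%N.
Proof.
move=> s0.
have -> : Xset K f = [set proj_class u | u in edge_torus].
  by rewrite /edge_torus -imset_comp.
apply: card_imset_fibres => u uM.
have -> : [set v in edge_torus | proj_class v == proj_class u]
          = [set c *: u | c in edge_scalars].
  apply/setP => v; rewrite inE eq_sym proj_class_eq.
  apply/andP/imsetP => [[vM /existsP[c /andP[c0 /eqP E]]]|[c]].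
    by exists c => //; rewrite inE c0 -(edge_torus_scale c uM) -E.
  rewrite inE => /andP[c0 cM] ->; rewrite edge_torus_scale //.
  by split=> //; apply/existsP; exists c; rewrite c0 eqxx.
(* As [s > 0] there is a first coordinate; it is nonzero in [u], so distinct scalars give distinct
   multiples. *)
apply: card_imset => c d /rowP/(_ (Ordinal s0)); rewrite !mxE.
by apply: mulIf; apply: edge_torus_neq0.
Qed.

End EdgeMonomials.

(** * The scalars in terms of the graph *)

Section EdgeScalars.

Variables (K : finFieldType) (n s : nat) (G : sgraph n).
Variables (f : 'I_s -> {set 'I_n}) (hf : edge_listing G f).

Lemma listed_edge i : f i \in edges G.
Proof. by case: hf => _ <-; apply: imset_f. Qed.

Lemma card_listed_edge i : #|f i| = 2%N.
Proof. exact: edges_card2 (listed_edge i). Qed.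

Lemma edge_scalarsP (c : K) :
  reflect (c != 0 /\ exists2 x : 'rV[K]_n, x \in torus K n &
             forall i, \prod_(j in f i) x 0 j = c)
          (c \in edge_scalars K f).
Proof.
rewrite inE; apply: (iffP andP) => -[c0].
  move=> /imsetP[x xT E]; split=> //; exists x => // i.
  by rewrite -edge_monomialsE -E mxE.
move=> [x xT E]; split=> //; apply/imsetP; exists x => //.
by apply/rowP => i; rewrite edge_monomialsE E mxE.
Qed.

Lemma edge_scalars_nonzero : edge_scalars K f \subset [set~ 0].
Proof. by apply/subsetP => c /edge_scalarsP[c0 _]; rewrite !inE. Qed.

(** The constant point [d] takes the value [d ^+ 2] on every edge, an edge having two ends. *)
Lemma nonzero_squares_scalars : nonzero_squares K \subset edge_scalars K f.
Proof.
apply/subsetP => c cS; apply/edge_scalarsP; split.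
  exact: nonzero_squares_neq0.
case/imsetP: cS => d; rewrite !inE => d0 ->; exists (const_mx d).
  by apply/torusP => j; rewrite mxE.
move=> i; rewrite -(card_listed_edge i) -prodr_const.
by apply: eq_bigr => j _; rewrite mxE.
Qed.

Lemma bipartite_scalars : bipartite G -> edge_scalars K f = [set~ 0].
Proof.
move=> [V1 [V2 [_ dis hE]]]; apply/eqP; rewrite eqEsubset edge_scalars_nonzero.
apply/subsetP => c; rewrite in_setC1 => c0; apply/edge_scalarsP; split=> //.
exists (\row_j if j \in V1 then c else 1).
  by apply/torusP => j; rewrite mxE; case: ifP => // _; rewrite oner_neq0.
move=> i; have [y [z [yV zV ->]]] := hE _ (listed_edge i).
have zV1 : z \notin V1 by apply/negP => zV1; rewrite (disjointFr dis zV1) in zV.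
have yz : y != z by apply: contraNneq zV1 => <-.
by rewrite big_setU1 ?inE //= big_set1 !mxE yV (negbTE zV1) mulr1.
Qed.

(** Every nonzero element is now a square, so the lower bound by squares meets the upper bound
    [K^*]. *)
Lemma even_card_scalars : ~~ odd #|K| -> edge_scalars K f = [set~ 0].
Proof.
move=> qe; apply/eqP; rewrite eqEsubset edge_scalars_nonzero.
apply: subset_trans nonzero_squares_scalars; apply/subsetP => c.
rewrite in_setC1 => c0; apply/imsetP; exists (c ^+ #|K|./2).
  by rewrite !inE expf_neq0.
exact: even_card_square.
Qed.

Lemma nonbipartite_scalars :
  odd #|K| -> ~ bipartite G -> edge_scalars K f = nonzero_squares K.
Proof.
move=> qo nb; apply/eqP; rewrite eqEsubset nonzero_squares_scalars andbT.
apply/subsetP => c /edge_scalarsP[c0 [x /torusP x0 xE]].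
apply/negPn/negP => cS; apply: nb.
exists [set j | x 0 j \in nonzero_squares K],
       [set j | x 0 j \notin nonzero_squares K]; split.
- by apply/setP => j; rewrite !inE orbN.
- by apply/pred0P => j; rewrite /= !inE andbN.
move=> e; case: hf => _ <- /imsetP[i _ ->].
have /eqP/cards2P[y [z [yz E]]] := card_listed_edge i.
have := xE i; rewrite E big_setU1 ?inE //= big_set1 => xyz.
(* Ends of the same kind, both squares or both nonsquares, would make their product [c] a square. *)
have [yS|yS] := boolP (x 0 y \in nonzero_squares K);
  have [zS|zS] := boolP (x 0 z \in nonzero_squares K).
- case/negP: cS; rewrite -xyz; case/imsetP: yS => a; rewrite !inE => a0 ->.
  case/imsetP: zS => b; rewrite !inE => b0 ->; apply/imsetP; exists (a * b).
    by rewrite !inE mulf_neq0.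
  by rewrite exprMn.
- by exists y, z; rewrite !in_set yS zS.
- by exists z, y; rewrite !in_set yS zS setUC.
- by case/negP: cS; rewrite -xyz nonsquare_mul.
Qed.

End EdgeScalars.

Local Close Scope ring_scope.

Theorem theorem2p8 (K : finFieldType) (q : nat) (hK : #|K| = q) (hq : q <> 2)
    (n s : nat) (hs : 0 < s) (G : sgraph n)
    (f : 'I_s -> {set 'I_n}) (hf : edge_listing G f) :
  [/\ bipartite G -> #|Yset K f| = (q - 1) * #|Xset K f|,
      gcdn (q - 1) 2 = 1 -> #|Yset K f| = (q - 1) * #|Xset K f| &
      ~ bipartite G -> gcdn (q - 1) 2 <> 1 ->
        #|Yset K f| = ((q - 1) %/ 2) * #|Xset K f|].
Proof.
have cK : #|[set~ (0%R : K)]| = q - 1 by rewrite card_nonzero hK subn1.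
(* The truncated [q - 1] has parity opposite to [q] because [q] is positive. *)
have gcdE : (gcdn (q - 1) 2 == 1) = ~~ odd #|K|.
  have q0 : 0 < q by rewrite -hK; apply/card_gt0P; exists 0%R.
  by rewrite -/(coprime _ _) coprimen2 oddB // hK addbT.
rewrite card_Yset card_edge_torus //; split.
- by move=> bG; rewrite (bipartite_scalars K hf bG) cK.
- by move=> /eqP; rewrite gcdE => qe; rewrite (even_card_scalars hf qe) cK.
- move=> nb /eqP; rewrite gcdE negbK => qo.
  (* The division is exact: [q - 1] is twice the number of nonzero squares. *)
  by rewrite (nonbipartite_scalars hf qo nb) -cK card_nonzero_squares // mulKn.
Qed.
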